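(* Let $T$ be a degenerate exactly-solvable operator of order $k$ consisting of precisely two terms: $T=Q_{j_0}D^{j_0}+Q_kD^{k}$. Then there exists a positive constant $c$ such that $$\liminf_{n\to\infty}\frac{r_n}{n^d}\geq c,$$ where $d:=\max_{j\in[j_0+1,k]}\big(\frac{j-j_0}{j-\deg Q_j}\big)=\frac{k-j_0}{k-\deg Q_k}$.
   Context: Here $D=d/dz$, and $[a,b]$ as a range for the index $j$ denotes integers. A degenerate exactly-solvable operator of order $k$ is a linear differential operator $T=\sum_{j=1}^{k}Q_jD^j$ with polynomial coefficients $Q_j\in\mathbb{C}[z]$, $Q_k\not\equiv 0$, such that $\deg Q_j\leq j$ for all $j$, with equality for at least one $j$, and $\deg Q_k<k$. In the two-term operator $T=Q_{j_0}D^{j_0}+Q_kD^k$ one has $1\le j_0<k$ and, by the preceding definition, $\deg Q_{j_0}=j_0$. For all sufficiently large integers $n$ there exist a unique constant $\lambda_n$ and a unique monic polynomial $p_n$ of degree $n$ with $T(p_n)=\lambda_n p_n$. For such $n$, $r_n=\max\{|z|:p_n(z)=0\}$. Maxima over $j$ are taken only over those $j$ for which $Q_j$ is not identically zero. *)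

(* Defs.v *)
From mathcomp Require Export all_boot all_order all_algebra.
From mathcomp Require Export all_classical all_reals all_analysis.
From mathcomp Require Export complex.

Set Implicit Arguments.
Unset Strict Implicit.
Unset Printing Implicit Defensive.
Import Order.TTheory GRing.Theory Num.Theory ComplexField.Normc.
Local Open Scope classical_set_scope.
Local Open Scope complex_scope.
Local Open Scope ring_scope.

(* [size p = 1 + deg p] for [p != 0]; the value at [0] is a junk [0]. *)
Definition pdeg (K : nzRingType) (p : {poly K}) : nat := (size p).-1.

Section ExactlySolvable.
Variable R : realType.
Implicit Types (k n : nat) (Q : nat -> {poly R[i]}) (p : {poly R[i]}).

(* T = \sum_(1 <= j <= k) Q_j D^j; the values of [Q] outside [1, k] are unused. *)
Definition diffop k Q p : {poly R[i]} :=
  \sum_(1 <= j < k.+1) Q j * p^`(j).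

(* Degree bounds are stated with [size] so that the zero polynomial satisfies
   deg 0 <= j and never satisfies deg 0 = j. *)
Definition degenerate_exactly_solvable k Q : Prop :=
  [/\ Q k != 0,
      (forall j, (1 <= j <= k)%N -> (size (Q j) <= j.+1)%N),
      (exists2 j, (1 <= j <= k)%N & size (Q j) = j.+1) &
      (size (Q k) < k.+1)%N].

Definition is_eigenpoly k Q n p : Prop :=
  [/\ p \is monic, size p = n.+1 &
      exists lambda : R[i], diffop k Q p = lambda *: p].

(* For all sufficiently large [n] there is exactly one such polynomial; the
   default value [0] can only occur for finitely many [n]. *)
Definition eigenpoly k Q n : {poly R[i]} := xget 0 [set p | is_eigenpoly k Q n p].

Definition max_root_modulus p : R := sup [set normc z | z in [set z | root p z]].

(* The supremum is a maximum as soon as [p] is not constant. *)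
Lemma max_root_modulusP p : (1 < size p)%N ->
  (exists2 z, root p z & normc z = max_root_modulus p) /\
  (forall z, root p z -> normc z <= max_root_modulus p).
Proof.
move=> sp.
have p0 : p != 0 by rewrite -size_poly_gt0 (leq_trans _ sp).
have [s Ds] := closed_field_poly_normal p.
have rootE z : root p z = (z \in s).
  by rewrite Ds rootZ ?lead_coef_eq0// root_prod_XsubC.
have [z0 rz0] : exists z, root p z.
  by apply/closed_rootP; rewrite neq_ltn sp orbT.
have : exists2 z, z \in s & forall w, w \in s -> normc w <= normc z.
  move: rz0; rewrite rootE; elim: (s) z0 {Ds rootE} => // a t IH z0 _.
  case: t IH => [|b t] IH.
    by exists a; [rewrite mem_head | move=> w; rewrite inE => /eqP ->].
  have [z zt zmax] := IH b (mem_head _ _).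
  have [za|az] := leP (normc z) (normc a).
    exists a; first exact: mem_head.
    by move=> w; rewrite inE => /orP[/eqP ->//|/zmax wz]; exact: le_trans za.
  exists z; first by rewrite inE zt orbT.
  by move=> w; rewrite inE => /orP[/eqP ->|/zmax//]; exact: ltW.
move=> [z zs zmax].
suff -> : max_root_modulus p = normc z.
  by split; [exists z; rewrite ?rootE | move=> w; rewrite rootE => /zmax].
apply/eqP; rewrite eq_le; apply/andP; split.
- apply: ge_sup; first by exists (normc z); exists z => //=; rewrite rootE.
  by move=> _ [w /= rw <-]; apply: zmax; rewrite -rootE.
- apply: ub_le_sup; last by exists z => //=; rewrite rootE.
  by exists (normc z) => _ [w /= rw <-]; apply: zmax; rewrite -rootE.
Qed.

(* Every term is nonnegative in the cases of interest, so the initial value [0]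
   does not affect the maximum. *)
Definition growth_exponent k j0 Q : R :=
  \big[Num.max/0]_(j0.+1 <= j < k.+1 | Q j != 0)
    ((j%:R - j0%:R) / (j%:R - (pdeg (Q j))%:R)).

End ExactlySolvable.

(* Main.v *)
Require Import Defs.
From mathcomp Require Import ring zify.
Import Order.TTheory GRing.Theory Num.Theory.
Local Open Scope classical_set_scope.
Local Open Scope complex_scope.
Local Open Scope ring_scope.

(** Evaluate the eigenvalue equation at a point [z] with [|z| >= 2 r_n].  All
    zeros of [p_n], hence by Gauss-Lucas those of its derivatives, have modulus
    at most [|z| / 2], so each logarithmic derivative [p^(i+1)(z) / p^(i)(z)] is
    comparable to [(n - i) / z].  Therefore [Q_k p^(k)] has size at least a
    multiple of [|z|^(deg Q_k - k) n^k |p(z)|], whereas [lambda_n p] and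
    [Q_j0 p^(j0)] are [O(n^j0 |p(z)|)].  Hence [|z|^(k - deg Q_k)] is at least a
    multiple of [n^(k - j0)].  Taking [|z| = max(2 r_n, M)] with [M] constant,
    the maximum must be [2 r_n] for large [n]; in particular there is no need to
    know beforehand that [r_n] tends to infinity.  Existence of [p_n] follows
    from [T] being triangular in the monomial basis with diagonal entries
    [lambda_m] that are eventually distinct. *)

(** * Degrees of derivatives in characteristic zero *)

Lemma char0_size_deriv (F : numDomainType) (p : {poly F}) :
  size p^`() = (size p).-1.
Proof.
have [->|p0] := eqVneq p 0; first by rewrite deriv0 size_poly0.
have /eqP Hs : size p == (size p).-1.+1 by rewrite prednK ?size_poly_gt0.
apply/eqP; rewrite eqn_leq; apply/andP; split.
  by rewrite -ltnS -Hs lt_size_deriv.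
case E : (size p).-1 => [//|m].
rewrite ltnNge; apply/negP => /(nth_default 0)/eqP.
by rewrite coef_deriv mulrn_eq0/= -E -/(lead_coef p) lead_coef_eq0 (negPf p0).
Qed.

Lemma char0_size_derivn (F : numDomainType) (p : {poly F}) i :
  size p^`(i) = (size p - i)%N.
Proof.
elim: i => [|i IH]; first by rewrite derivn0 subn0.
by rewrite derivnS char0_size_deriv IH subnS.
Qed.

(** * Bounds on derivatives outside a disc containing all zeros *)

Section LogDerivative.
Variable C : numClosedFieldType.
Implicit Types (p : {poly C}) (z w : C).

Lemma Re_div_sub_ge z w : `|w| <= `|z| -> z != w -> 2^-1 <= 'Re (z / (z - w)).
Proof.
(* 2 Re (z / (z - w)) - 1 = (|z|^2 - |w|^2) / |z - w|^2 *)
move=> wz zw; have u0 : z - w != 0 by rewrite subr_eq0.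
have u0' : (z - w)^* != 0 by rewrite conjC_eq0.
have n0 : 0 < (z - w) * (z - w)^* by rewrite -normCK exprn_gt0 ?normr_gt0.
have -> : 'Re (z / (z - w)) =
    2^-1 + (`|z| ^+ 2 - `|w| ^+ 2) / (2 * ((z - w) * (z - w)^*)).
  rewrite ReE [(z / (z - w))^*]rmorphM /= fmorphV !normCK.
  move: u0' => /[!rmorphB] u0'; field.
  by rewrite u0 u0'.
rewrite lerDl; apply: divr_ge0; last by rewrite pmulr_rge0// ltW.
by rewrite subr_ge0 lerXn2r ?nnegrE.
Qed.

Lemma horner_deriv_prod_XsubC (s : seq C) z : z \notin s ->
  (\prod_(w <- s) ('X - w%:P))^`().[z] =
  (\prod_(w <- s) ('X - w%:P)).[z] * \sum_(w <- s) (z - w)^-1.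
Proof.
elim: s => [|a s IH]; first by rewrite !big_nil mulr0 -polyC1 derivC horner0.
rewrite inE negb_or !big_cons => /andP[za zs].
have u0 : z - a != 0 by rewrite subr_eq0.
rewrite derivM derivXsubC !hornerE IH//; field.
by rewrite u0.
Qed.

(** The list [s] repeats roots by multiplicity, so the sum has exactly deg [p] terms. *)
Lemma horner_deriv_logE p z : p.[z] != 0 -> exists s : seq C,
  [/\ size s = (size p).-1, forall w, (w \in s) = root p w &
      p^`().[z] = p.[z] * \sum_(w <- s) (z - w)^-1].
Proof.
move=> pz.
have p0 : p != 0 by apply: contraNneq pz => ->; rewrite horner0.
have [s Ds] := closed_field_poly_normal p.
have sE w : root p w = (w \in s).
  by rewrite Ds rootZ ?lead_coef_eq0// root_prod_XsubC.
exists s; split=> //.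
  by rewrite Ds size_scale ?lead_coef_eq0// size_prod_XsubC.
have zs : z \notin s by rewrite -sE.
by rewrite Ds derivZ !hornerZ horner_deriv_prod_XsubC// mulrA.
Qed.

(** The real part of [z * p'(z) / p(z)] is a sum of deg [p] terms ['Re (z / (z - w))], each at least
    1/2. *)
Lemma norm_deriv_ge p z : (forall w, root p w -> `|w| < `|z|) ->
  (size p).-1%:R * `|p.[z]| <= 2 * `|z| * `|p^`().[z]|.
Proof.
move=> pz; have [pz0|pz0] := eqVneq p.[z] 0.
  by have := pz z; rewrite rootE pz0 eqxx ltxx => /(_ isT).
have [s [<- sE ->]] := horner_deriv_logE p z pz0.
rewrite normrM mulrCA [leLHS]mulrC ler_wpM2l// -mulrA -normrM [leRHS]mulrC -ler_pdivrMr//.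
apply: le_trans (leif_normC_Re_Creal _).1.
apply: le_trans (real_ler_norm (Creal_Re _)).
rewrite mulr_sumr raddf_sum/= -sum1_size natr_sum mulr_suml.
rewrite big_seq [leRHS]big_seq; apply: ler_sum => w ws.
have wz : `|w| < `|z| by apply: pz; rewrite -sE.
rewrite div1r Re_div_sub_ge ?(ltW wz)//.
by apply: contraTneq wz => ->; rewrite ltxx.
Qed.

(** Here [|z - w| >= |z| / 2] for every root [w], so each term [z / (z - w)] has modulus at most
    2. *)
Lemma norm_deriv_le p z : (forall w, root p w -> 2 * `|w| <= `|z|) ->
  `|z| * `|p^`().[z]| <= 2 * (size p).-1%:R * `|p.[z]|.
Proof.
move=> pz; have [->|z0] := eqVneq z 0; first by rewrite normr0 mul0r mulr_ge0.
have z0' : 0 < `|z| by rewrite normr_gt0.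
have [pz0|pz0] := eqVneq p.[z] 0.
  have := pz z; rewrite rootE pz0 eqxx => /(_ isT).
  by rewrite ger_pMl// lt_geF// ltr1n.
have [s [<- sE ->]] := horner_deriv_logE p z pz0.
rewrite normrM mulrCA mulrC ler_wpM2r// -normrM mulr_sumr.
apply: le_trans (ler_norm_sum _ _ _) _.
rewrite -sum1_size natr_sum mulr_sumr.
rewrite big_seq [leRHS]big_seq; apply: ler_sum => w ws; rewrite mulr1.
have wz : 2 * `|w| <= `|z| by apply: pz; rewrite -sE.
have zw : `|z| <= 2 * `|z - w|.
  have := lerB_dist z w => H.
  apply: le_trans (ler_wpM2l _ H) => //.
  by rewrite mulrBr lerBrDr [in leRHS]mulr_natl [leRHS]mulr2n lerD2l.
have zw0 : 0 < `|z - w| by rewrite -(pmulr_rgt0 _ (ltr0n C 2)) (lt_le_trans z0').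
by rewrite normrM normfV ler_pdivrMr.
Qed.

(** Gauss-Lucas for a disc centred at 0: at a critical point outside the disc, [norm_deriv_ge] would
    force [p] itself to vanish. *)
Lemma root_deriv_le p (r : C) : r \is Num.real -> (1 < size p)%N ->
  (forall w, root p w -> `|w| <= r) -> forall w, root p^`() w -> `|w| <= r.
Proof.
move=> rr sp pr z; rewrite rootE => /eqP p'z.
rewrite real_leNgt ?normr_real//; apply/negP => rz.
have /norm_deriv_ge : forall w, root p w -> `|w| < `|z|.
  by move=> w /pr wr; exact: le_lt_trans rz.
rewrite p'z normr0 mulr0.
have n0 : (0 : C) < (size p).-1%:R by rewrite ltr0n -subn1 subn_gt0.
rewrite pmulr_rle0// normr_le0 -rootE => /pr.
by rewrite lt_geF.
Qed.

Lemma root_derivn_le p (r : C) i : r \is Num.real -> (i < size p)%N ->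
  (forall w, root p w -> `|w| <= r) -> forall w, root p^`(i) w -> `|w| <= r.
Proof.
move=> rr + pr; elim: i => [_|i IH ip]; first by rewrite derivn0.
rewrite derivnS; apply: root_deriv_le (IH (ltnW ip)) => //.
by rewrite char0_size_derivn ltn_subRL addn1.
Qed.

(** Iterating [norm_deriv_ge] multiplies the successive degrees of the derivatives, which yields the
    falling factorial; Gauss-Lucas keeps their roots in the disc. *)
Lemma norm_derivn_ge p z (r : C) i : r < `|z| -> (i < size p)%N ->
  (forall w, root p w -> `|w| <= r) ->
  ((size p).-1 ^_ i)%:R * `|p.[z]| <= (2 * `|z|) ^+ i * `|p^`(i).[z]|.
Proof.
move=> rz + pr; have rr : r \is Num.real.
  by rewrite (ler_real (ltW rz)) ?normr_real.
elim: i => [_|i IH ip]; first by rewrite derivn0 expr0 !mul1r.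
rewrite ffactnSr natrM mulrAC derivnS exprSr.
apply: le_trans (ler_wpM2r _ (IH (ltnW ip))) _ => //.
rewrite mulrAC -!mulrA ler_wpM2l ?exprn_ge0 ?mulr_ge0// mulrA.
have -> : ((size p).-1 - i)%N = (size p^`(i)).-1.
  by rewrite char0_size_derivn -!subn1 subnAC.
apply: norm_deriv_ge => w wr.
by apply: le_lt_trans rz; apply: root_derivn_le wr => //; exact: ltnW.
Qed.

Lemma norm_derivn_le p z (r : C) i : 2 * r <= `|z| -> (i < size p)%N ->
  (forall w, root p w -> `|w| <= r) ->
  `|z| ^+ i * `|p^`(i).[z]| <= 2 ^+ i * ((size p).-1 ^_ i)%:R * `|p.[z]|.
Proof.
move=> rz + pr; have rr : r \is Num.real.
  have : 2 * r \is Num.real by rewrite (ler_real rz) ?normr_real.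
  by apply: contraTT => rn; rewrite realMr ?pnatr_eq0 ?realn.
elim: i => [_|i IH ip]; first by rewrite derivn0 !expr0 !mul1r.
rewrite ffactnSr natrM derivnS exprSr -mulrA.
have H : `|z| * `|p^`(i)^`().[z]| <=
         2 * ((size p).-1 - i)%:R * `|p^`(i).[z]|.
  have -> : ((size p).-1 - i)%N = (size p^`(i)).-1.
    by rewrite char0_size_derivn -!subn1 subnAC.
  apply: norm_deriv_le => w wr; apply: le_trans rz.
  by rewrite ler_wpM2l//; apply: root_derivn_le wr => //; exact: ltnW.
apply: le_trans (ler_wpM2l _ H) _; first by rewrite exprn_ge0.
rewrite mulrCA; apply: le_trans (ler_wpM2l _ (IH (ltnW ip))) _.
  by rewrite mulr_ge0.
by rewrite le_eqVlt; apply/orP; left; apply/eqP; rewrite exprSr; ring.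
Qed.
End LogDerivative.

(** * Growth of a polynomial at infinity *)

Section PolyGrowth.
Variable F : numFieldType.
Implicit Types (p : {poly F}) (z : F).

(** The extra factor [|z|] stands in for the exponent [m - 1], so that [m = 0] needs no separate
    case. *)
Lemma horner_norm_le p m z : (size p <= m)%N -> 1 <= `|z| ->
  `|z| * `|p.[z]| <= (\sum_(i < size p) `|p`_i|) * `|z| ^+ m.
Proof.
move=> pm z1; rewrite horner_coef.
apply: le_trans (ler_wpM2l _ (ler_norm_sum _ _ _)) _ => //.
rewrite mulr_sumr mulr_suml; apply: ler_sum => i _.
rewrite normrM normrX mulrCA -exprS ler_wpM2l// ler_weXn2l//.
exact: leq_trans pm.
Qed.

Lemma horner_norm_ge p : p != 0 -> exists2 c : F, 0 < c &
  exists2 M : F, 0 < M &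
   forall z, M <= `|z| -> c * `|z| ^+ (size p).-1 <= `|p.[z]|.
Proof.
move=> p0; set m := (size p).-1; set a := lead_coef p.
have a0 : 0 < `|a| by rewrite normr_gt0 lead_coef_eq0.
pose g := p - a *: 'X^m.
have gs : (size g <= m)%N.
  apply/leq_sizeP => j; rewrite leq_eqVlt => /predU1P[<-|mj].
    by rewrite !coefE eqxx mulr1 subrr.
  rewrite !coefE (gtn_eqF mj) mulr0 subr0 nth_default//.
  by rewrite -(prednK (_ : 0 < size p)%N) ?size_poly_gt0.
pose A := \sum_(i < size g) `|g`_i|.
have A0 : 0 <= A by apply: sumr_ge0.
exists (`|a| / 2); first by rewrite divr_gt0.
(* Beyond this threshold [|z| >= 1], and the lower-order part [g] is at most half of the leading
   term. *)
exists (1 + 2 * A / `|a|) => [|z Mz].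
  by rewrite ltr_pwDl// divr_ge0// mulr_ge0.
have z1 : 1 <= `|z| by apply: le_trans Mz; rewrite lerDl divr_ge0// mulr_ge0.
have z0 : 0 < `|z| by exact: lt_le_trans z1.
have zA : 2 * A <= `|a| * `|z|.
  rewrite -ler_pdivrMl// mulrC; apply: le_trans Mz.
  by rewrite lerDr.
rewrite -(ler_pM2l z0).
have -> : p.[z] = a * z ^+ m + g.[z].
  by rewrite /g hornerD hornerN hornerZ hornerXn addrC subrK.
have H1 := horner_norm_le _ _ _ gs z1; rewrite -/A in H1.
have H2 : `|a| * `|z| ^+ m - `|g.[z]| <= `|a * z ^+ m + g.[z]|.
  rewrite -normrX -normrM -(normrN g.[z]).
  by rewrite (le_trans (lerB_dist _ _))// opprK.
apply: le_trans (ler_wpM2l (ltW z0) H2).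
rewrite mulrBr lerBrDr.
apply: le_trans (lerD (lexx _) H1) _.
have -> : `|z| * (`|a| * `|z| ^+ m) = 
   `|z| * (`|a| / 2 * `|z| ^+ m) + (`|a| * `|z| / 2) * `|z| ^+ m.
  by field.
by rewrite lerD2l ler_wpM2r ?exprn_ge0// ler_pdivlMr// mulrC.
Qed.
End PolyGrowth.

(** * Linear operators triangular in the monomial basis, with diagonal [mu] *)

Section Triangular.
Variables (F : fieldType) (L : {poly F} -> {poly F}) (mu : nat -> F).
Hypothesis linL : linear L.
Hypothesis size_diagL :
  forall m (f : {poly F}), (size f <= m.+1)%N -> (size (L f - mu m *: f)%R <= m)%N.

(** Back-substitution from the top degree: no diagonal entry of [L - a] vanishes below [m]. *)
Lemma triangular_solve (a : F) m : (forall i, (i < m)%N -> mu i != a) ->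
  forall f : {poly F}, (size f <= m)%N -> exists2 g : {poly F}, (size g <= m)%N & L g - a *: g = f.
Proof.
have L0 : L 0 = 0.
  by have := linL (-1) 0 0; rewrite !scaleN1r oppr0 addr0 addNr.
elim: m => [|m IH] mua f sf.
  exists 0; rewrite ?size_poly0// L0 scaler0 subr0.
  by apply/esym/eqP; rewrite -size_poly_leq0.
have mua0 : mu m - a != 0 by rewrite subr_eq0 mua.
(* The coefficient of ['X^m] in the solution; subtracting its image leaves a right-hand side of size
   at most [m]. *)
pose b := f`_m / (mu m - a).
have sX : (size ('X^m : {poly F}) <= m.+1)%N by rewrite size_polyXn.
have [g sg Dg] : exists2 g : {poly F}, (size g <= m)%N &
    L g - a *: g = f - b *: (L 'X^m - a *: 'X^m).
  apply: IH => [i im|]; first by apply: mua; exact: ltnW.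
  have -> : f - b *: (L 'X^m - a *: 'X^m) =
      f - f`_m *: 'X^m - b *: (L 'X^m - mu m *: 'X^m).
    have -> : f`_m = b * (mu m - a) by rewrite divfK.
    by apply/polyP => i; rewrite !(coefB, coefZ); ring.
  apply: leq_trans (size_polyD _ _) _; rewrite size_polyN geq_max.
  rewrite (leq_trans (size_scale_leq _ _)) ?size_diagL// andbT.
  apply/leq_sizeP => j; rewrite leq_eqVlt => /predU1P[<-|mj].
    by rewrite !coefE eqxx mulr1 subrr.
  by rewrite !coefE (gtn_eqF mj) mulr0 subr0 nth_default// (leq_trans sf).
exists (b *: 'X^m + g).
  rewrite (leq_trans (size_polyD _ _))// geq_max (leq_trans sg)// andbT.
  by rewrite (leq_trans (size_scale_leq _ _)).
have -> : L (b *: 'X^m + g) = b *: L 'X^m + (a *: g + (L g - a *: g)).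
  by rewrite [a *: g + _]addrC subrK linL.
by rewrite Dg; apply/polyP => i; rewrite !(coefD, coefN, coefZ); ring.
Qed.

(** The image of ['X^n] under [L - mu n] has degree below [n], hence equals the image of some [g] of
    degree below [n]; the eigenvector is ['X^n - g]. *)
Lemma triangular_eigenvector n : (forall i, (i < n)%N -> mu i != mu n) ->
  exists p, [/\ p \is monic, size p = n.+1 & L p = mu n *: p].
Proof.
move=> mun.
have sX : (size ('X^n : {poly F}) <= n.+1)%N by rewrite size_polyXn.
have [g sg Dg] := triangular_solve (mu n) n mun _ (size_diagL n _ sX).
have sNg : (size (- g) < size ('X^n : {poly F}))%N.
  by rewrite size_polyN size_polyXn.
exists ('X^n - g); split.
- by rewrite monicE lead_coefDl// lead_coefXn.
- by rewrite size_polyDl// size_polyXn.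
have -> : L ('X^n - g) =  -1 *: (mu n *: g + (L g - mu n *: g)) + L 'X^n.
  by rewrite [mu n *: g + _]addrC subrK -linL scaleN1r addrC.
by rewrite Dg; apply/polyP => i; rewrite !(coefD, coefN, coefZ); ring.
Qed.

Lemma triangular_eigenvalue n (p : {poly F}) a : size p = n.+1 -> L p = a *: p -> a = mu n.
Proof.
move=> sp Lp; have := size_diagL n p; rewrite sp leqnn => /(_ isT).
rewrite Lp -scalerBl; apply: contraTeq => /negPf an.
by rewrite size_scale ?subr_eq0 ?an// sp ltnn.
Qed.
End Triangular.

(** * Top coefficients of products, and falling factorials *)

Lemma coefM_size (A : nzSemiRingType) (p q : {poly A}) a b :
  (size p <= a.+1)%N -> (size q <= b.+1)%N -> (p * q)`_(a + b) = p`_a * q`_b.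
Proof.
move=> pa qb; have ab : (a < (a + b).+1)%N by rewrite ltnS leq_addr.
rewrite coefM (bigD1 (Ordinal ab))//= addKn big1 ?addr0// => i ia.
have [ai|] := ltnP a i; first by rewrite [p`_i]nth_default ?mul0r ?(leq_trans pa).
rewrite leq_eqVlt => /predU1P[ia'|ia'].
  by case/eqP: ia; exact: val_inj.
rewrite [q`__]nth_default ?mulr0// (leq_trans qb)//.
by clear -ia'; lia.
Qed.

(** Each of the [i] additional factors of [n ^_ (j + i)] is at least [n / 2]. *)
Lemma ffact_mul_exp_le (n j i : nat) : (2 * (j + i) <= n)%N ->
  (n ^_ j * n ^ i <= 2 ^ i * n ^_ (j + i))%N.
Proof.
elim: i => [|i IH] ni; first by rewrite addn0 !expn0 mul1n muln1.
rewrite addnS ffactnSr !expnSr mulnA mulnACA leq_mul// ?IH; lia.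
Qed.

Lemma ltn_ffact (j m n : nat) : (0 < j <= n)%N -> (m < n)%N ->
  (m ^_ j < n ^_ j)%N.
Proof.
elim: j m n => [//|j IH] [|m] [|n]//= jn mn.
  by rewrite ffact_small ?ffact_gt0//.
rewrite !ffactSS.
case: j IH jn => [|j] IH jn; first by rewrite !ffactn0 !muln1.
by rewrite ltn_mul// IH.
Qed.

(** * The two-term operator: its eigenpolynomials and the main estimate *)

Section TwoTerm.
Variables (R : realType) (k j0 : nat) (Q : nat -> {poly R[i]}).
Hypotheses (hT : degenerate_exactly_solvable k Q) (hj0 : (1 <= j0 < k)%N)
  (htwo : forall j, (1 <= j <= k)%N -> j != j0 -> j != k -> Q j = 0).

Lemma diffop_two p : diffop k Q p = Q j0 * p^`(j0) + Q k * p^`(k).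
Proof.
rewrite /diffop (bigD1_seq j0) ?iota_uniq ?mem_index_iota//=; last by lia.
congr (_ + _).
rewrite big_mkcond (bigD1_seq k) ?iota_uniq ?mem_index_iota//=; last by lia.
rewrite ifT ?big1_seq ?addr0//; last by lia.
move=> j; rewrite mem_index_iota => /andP[jk jI]; case: ifPn => // jj0.
by rewrite htwo ?mul0r.
Qed.

(** The index where the degree bound is attained cannot be [k], by degeneracy, and the other
    coefficients vanish. *)
Lemma size_Qj0 : size (Q j0) = j0.+1.
Proof.
case: hT => _ _ [j jk Qj] Qk.
have [<-//|jj0] := eqVneq j j0.
have [jk'|jk'] := eqVneq j k; first by move: Qk; rewrite -jk' Qj ltnn.
by move: Qj; rewrite htwo// size_poly0.
Qed.

Lemma diffop_linear : linear (diffop k Q).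
Proof.
move=> a u v; rewrite !diffop_two !derivnD !derivnZ.
by rewrite !mulrDr -!scalerAr addrACA scalerDr.
Qed.

(** The coefficient of ['X^n] in the image of ['X^n]; the term with [Q k] lowers degrees because deg
    [Q k] is less than [k]. *)
Definition two_term_eigenvalue n : R[i] := lead_coef (Q j0) * (n ^_ j0)%:R.

Lemma size_diffop_diag m (f : {poly R[i]}) : (size f <= m.+1)%N ->
  (size (diffop k Q f - two_term_eigenvalue m *: f)%R <= m)%N.
Proof.
move=> sf; rewrite diffop_two addrAC.
have sk : (size (Q k * f^`(k))%R <= m)%N.
  have [->|fk0] := eqVneq f^`(k) 0; first by rewrite mulr0 size_poly0.
  have := size_polyMleq (Q k) f^`(k); move: fk0.
  rewrite -size_poly_gt0 char0_size_derivn => fk0 /leq_trans; apply.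
  case: hT => _ _ _; move: fk0 sf; move: (size (Q k)) (size f) => a b; lia.
apply: leq_trans (size_polyD _ _) _; rewrite geq_max sk andbT.
(* For [m < j0] both the derivative and the falling factorial vanish; otherwise the coefficients of
   degree [m] cancel. *)
have [mj|jm] := ltnP m j0.
  rewrite /two_term_eigenvalue ffact_small// mulr0 scale0r subr0.
  have -> : f^`(j0) = 0.
    by apply/eqP; rewrite -size_poly_leq0 char0_size_derivn leq_subLR addn0
      (leq_trans sf).
  by rewrite mulr0 size_poly0.
have sfj : (size f^`(j0) <= (m - j0).+1)%N.
  by rewrite char0_size_derivn leq_subLR addnS subnKC.
apply/leq_sizeP => j; rewrite leq_eqVlt => /predU1P[<-|mj].
  rewrite coefB coefZ -{1}(subnKC jm) coefM_size ?size_Qj0//.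
  rewrite coef_derivn (subnKC jm) /two_term_eigenvalue lead_coefE size_Qj0.
  by rewrite -mulr_natr/=; ring.
rewrite coefB coefZ [f`_j]nth_default ?mulr0 ?subr0 ?(leq_trans sf)//.
rewrite nth_default// (leq_trans (size_polyMleq _ _))// size_Qj0/=.
by rewrite (leq_trans (leq_add (leqnn _) sfj))// addnS subnKC.
Qed.

Lemma two_term_eigenvalue_neq n i : (j0 <= n)%N -> (i < n)%N ->
  two_term_eigenvalue i != two_term_eigenvalue n.
Proof.
move=> jn i_n; rewrite /two_term_eigenvalue.
rewrite (inj_eq (mulfI _)); last first.
  by rewrite lead_coef_eq0 -size_poly_gt0 size_Qj0.
rewrite eqr_nat neq_ltn ltn_ffact//.
by case/andP: hj0 => -> _.
Qed.

(** Existence of an eigenpolynomial rules out the default value of [xget]. *)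
Lemma eigenpolyP n : (j0 <= n)%N -> is_eigenpoly k Q n (eigenpoly k Q n).
Proof.
move=> jn; apply: (@xgetPex _ 0 [set p | is_eigenpoly k Q n p]).
have [p [pm sp Tp]] := triangular_eigenvector _ _ _ diffop_linear
  size_diffop_diag n (fun i => two_term_eigenvalue_neq n i jn).
by exists p; split=> //; exists (two_term_eigenvalue n).
Qed.

(** The constants are chosen before [n], [p], [r] and [z], so the estimate is uniform in the
    degree. *)
Lemma eigenpoly_norm_bound : exists2 c : R[i], 0 < c & exists2 M : R[i], 0 < M &
  forall n p (r z : R[i]), (2 * k <= n)%N -> is_eigenpoly k Q n p ->
    (forall w, root p w -> `|w| <= r) -> 2 * r <= `|z| -> M <= `|z| ->
    c * n%:R ^+ (k - j0) <= `|z| ^+ (k - pdeg (Q k)).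
Proof.
case: (hT) => Qk0 _ _ sQk; case/andP: (hj0) => j0_gt0 j0k.
have [B B0 [M M0 QkM]] := horner_norm_ge _ (Q k) Qk0.
rewrite /pdeg; set m := (size (Q k)).-1 in QkM *.
pose A := \sum_(i < size (Q j0)) `|(Q j0)`_i|.
have A0 : 0 <= A by apply: sumr_ge0.
pose q := `|lead_coef (Q j0)|.
have q0 : 0 < q by rewrite normr_gt0 lead_coef_eq0 -size_poly_gt0 size_Qj0.
(* [q] accounts for the eigenvalue and [A * 2 ^+ j0] for the term of order [j0], both relative to
   [n ^_ j0] times [|p(z)|]. *)
pose K := q + A * 2 ^+ j0.
have K0 : 0 < K by rewrite ltr_pwDl// mulr_ge0// exprn_ge0.
have P0 : 0 < 2 ^+ (k - j0) * (2 ^+ k * K).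
  by rewrite !mulr_gt0// exprn_gt0.
(* [B] bounds [Q k] from below, [2 ^+ k] comes from [norm_derivn_ge], and [2 ^+ (k - j0)] from
   replacing falling factorials by powers of [n]. *)
exists (B / (2 ^+ (k - j0) * (2 ^+ k * K))); first by rewrite divr_gt0.
exists (M + 1); first by rewrite addr_gt0.
move=> n p r z kn [pm sp [a Tp]] pr rz Mz.
have {}Tp : Q j0 * p^`(j0) + Q k * p^`(k) = two_term_eigenvalue n *: p.
  rewrite -diffop_two Tp; congr (_ *: _).
  exact: triangular_eigenvalue size_diffop_diag _ _ _ sp Tp.
have z1 : 1 <= `|z| by rewrite (le_trans _ Mz)// lerDr ltW.
have {}Mz : M <= `|z| by rewrite (le_trans _ Mz)// lerDl.
have z0 : 0 < `|z| by exact: lt_le_trans z1.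
have rz' : r < `|z|.
  rewrite -(ltr_pM2l (ltr0n R[i] 2)) (le_lt_trans rz)//.
  by rewrite ltr_pMl// ltr1n.
have pz0 : 0 < `|p.[z]|.
  by rewrite normr_gt0 -rootE; apply: contraTN rz' => /pr zr; rewrite le_gtF.
have {}kn : (k <= n)%N /\ (2 * k <= n)%N by rewrite (leq_trans _ kn) ?leq_pmull.
case: kn => k_n kn; have kp : (k < size p)%N by rewrite sp.
have Hk := norm_derivn_ge _ p z r k rz' kp pr.
have Hj := norm_derivn_le _ p z r j0 rz (ltn_trans j0k kp) pr.
rewrite sp/= in Hk Hj.
have n0 : 0 < (n ^_ j0)%:R :> R[i] by rewrite ltr0n ffact_gt0 (leq_trans (ltnW j0k)).
have HQj : `|(Q j0).[z]| <= A * `|z| ^+ j0.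
  rewrite -(ler_pM2l z0); apply: le_trans (horner_norm_le _ _ j0.+1 z _ z1) _.
    by rewrite size_Qj0.
  by rewrite exprS mulrCA.
have Hj' : `|(Q j0).[z] * p^`(j0).[z]| <=
    A * 2 ^+ j0 * (n ^_ j0)%:R * `|p.[z]|.
  rewrite normrM; apply: le_trans (ler_wpM2r _ HQj) _ => //.
  by rewrite -!mulrA ler_wpM2l// mulrA.
have HQk : `|(Q k).[z] * p^`(k).[z]| <= K * (n ^_ j0)%:R * `|p.[z]|.
  have -> : (Q k).[z] * p^`(k).[z] =
      two_term_eigenvalue n * p.[z] - (Q j0).[z] * p^`(j0).[z].
    have := congr1 (horner^~ z) Tp; rewrite /= hornerD !hornerM hornerZ => <-.
    by rewrite [X in X - _]addrC addrK.
  apply: le_trans (ler_normB _ _) _.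
  rewrite /K !mulrDl lerD// !normrM normr_nat.
  by [].
(* The lower and upper bounds for the term of order [k] meet here, and the factor [|p(z)|]
   cancels. *)
have Hn : B * `|z| ^+ m * (n ^_ k)%:R <= (2 * `|z|) ^+ k * (K * (n ^_ j0)%:R).
  rewrite -(ler_pM2r pz0) -[leLHS]mulrA; apply: le_trans (ler_pM _ _ (QkM z Mz) Hk) _.
  - by rewrite mulr_ge0 ?exprn_ge0// ltW.
  - by rewrite mulr_ge0.
  - by rewrite mulrCA -normrM -!mulrA ler_wpM2l ?exprn_ge0 ?mulr_ge0// !mulrA.
have Hf : (n ^_ j0)%:R * n%:R ^+ (k - j0) <= 2 ^+ (k - j0) * (n ^_ k)%:R :> R[i].
  rewrite -!natrX -!natrM ler_nat.
  by have := ffact_mul_exp_le n j0 (k - j0); rewrite (subnKC (ltnW j0k)); apply.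
have mk : (m <= k)%N by rewrite (leq_trans (leq_pred _)).
have zm0 : 0 < `|z| ^+ m by rewrite exprn_gt0.
(* Restoring the factors [n ^_ j0] and [|z| ^+ m] lets [Hf] and [Hn] be chained without division. *)
rewrite mulrAC ler_pdivrMr// -(ler_pM2r n0) -(ler_pM2r zm0).
have -> : B * n%:R ^+ (k - j0) * (n ^_ j0)%:R * `|z| ^+ m =
  B * `|z| ^+ m * ((n ^_ j0)%:R * n%:R ^+ (k - j0)) by ring.
apply: le_trans (ler_wpM2l _ Hf) _; first by rewrite mulr_ge0 ?(ltW zm0)// ltW.
rewrite mulrCA.
apply: le_trans (ler_wpM2l _ Hn) _; first by rewrite exprn_ge0.
have zk : `|z| ^+ k = `|z| ^+ (k - m) * `|z| ^+ m by rewrite -exprD subnK.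
by rewrite exprMn zk le_eqVlt; apply/orP; left; apply/eqP; ring.
Qed.
End TwoTerm.

(** * Lower limit, growth exponent and conclusion *)

Lemma limn_einf_ge (R : realType) (u : nat -> \bar R) (c : \bar R) N :
  (forall n, (N <= n)%N -> (c <= u n)%E) -> (c <= limn_einf u)%E.
Proof.
move=> cu; rewrite limn_einf_lim; apply: lime_ge; first exact: is_cvg_einfs.
exists N => // n /= Nn; apply: le_ereal_inf_tmp => _ [m /= nm <-].
by apply: cu; exact: leq_trans nm.
Qed.

(** Only [j = k] survives in the range, and its ratio is nonnegative, so the initial value 0 is
    absorbed. *)
Lemma growth_exponent_two (R : realType) (k j0 : nat) (Q : nat -> {poly R[i]}) :
  degenerate_exactly_solvable k Q -> (1 <= j0 < k)%N ->
  (forall j, (1 <= j <= k)%N -> j != j0 -> j != k -> Q j = 0) ->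
  growth_exponent k j0 Q = (k%:R - j0%:R) / (k%:R - (pdeg (Q k))%:R).
Proof.
move=> [Qk0 _ _ sQk] /andP[j0_gt0 j0k] htwo.
have -> : growth_exponent k j0 Q =
    \big[Num.max/0]_(j <- [:: k]) ((j%:R - j0%:R) / (j%:R - (pdeg (Q j))%:R)).
  rewrite /growth_exponent -big_filter; congr (\big[_/_]_(j <- _) _).
  rewrite /index_iota subSS -(subnSK j0k) -[(_ - _).+1]addn1 iotaD subnKC// filter_cat/= Qk0.
  rewrite -[RHS]cat0s; congr (_ ++ _).
  apply/eqP; rewrite -(negbK (_ == _)) -has_filter -all_predC; apply/allP => j.
  rewrite mem_iota subnKC// => /andP[j0j jk] /=; rewrite negbK; apply/eqP.
  apply: htwo; last by rewrite ltn_eqF.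
    by rewrite (leq_ltn_trans _ j0j)// ltnW.
  by rewrite gtn_eqF.
rewrite big_cons big_nil max_l//.
rewrite divr_ge0// subr_ge0 ler_nat; first exact: ltnW.
by rewrite (leq_trans (leq_pred _)).
Qed.

(** Positive elements of [R[i]] are real, which carries the constants back to [R]. *)
Lemma gt0_real_complex (R : realType) (x : R[i]) :
  0 < x -> exists2 y : R, 0 < y & x = y%:C.
Proof.
move=> x0; exists (ComplexField.Normc.normc x); last by rewrite -{1}[x]gtr0_norm.
by rewrite -ltcR -[X in _ < X]/`|x| gtr0_norm.
Qed.

Theorem theorem3 (R : realType) (k j0 : nat) (Q : nat -> {poly R[i]})
    (hT : degenerate_exactly_solvable k Q)
    (hj0 : (1 <= j0 < k)%N)
    (hQj0 : Q j0 != 0)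
    (htwo : forall j, (1 <= j <= k)%N -> j != j0 -> j != k -> Q j = 0) :
  let d : R := growth_exponent k j0 Q in
  d = (k%:R - j0%:R) / (k%:R - (pdeg (Q k))%:R) /\
  exists c : R, 0 < c /\
    (c%:E <= limn_einf (fun n : nat =>
       (max_root_modulus (eigenpoly k Q n) / (n%:R `^ d))%:E))%E.
Proof.
move=> d.
have dE : d = (k%:R - j0%:R) / (k%:R - (pdeg (Q k))%:R).
  exact: growth_exponent_two.
split=> //.
have [_ /gt0_real_complex[c c_gt0 ->] [_ /gt0_real_complex[M M_gt0 ->] bound]] :=
  eigenpoly_norm_bound _ _ _ _ hT hj0 htwo.
have [j0_gt0 j0k] := andP hj0.
have mk : (pdeg (Q k) < k)%N.
  case: hT => Qk0 _ _; rewrite ltnS; apply: leq_trans.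
  by rewrite /pdeg prednK// size_poly_gt0.
move: dE; rewrite -!natrB ?(ltnW mk) ?(ltnW j0k)//.
set s := (k - j0)%N in bound *; set e := (k - pdeg (Q k))%N => dE.
have s0 : (0 < s)%N by rewrite subn_gt0.
have e0 : (0 < e)%N by rewrite subn_gt0.
have e0R : e%:R != 0 :> R by rewrite pnatr_eq0 -lt0n.
(* Comes from the [e]-th root of [c * n ^ s <= (2 * r) ^ e], since [d = s / e]. *)
exists (c `^ e%:R^-1 / 2); split; first by rewrite divr_gt0// powR_gt0.
(* The first entry permits the uniform estimate; the second gives [M ^ e < c * n <= c * n ^ s]. *)
pose N := maxn (2 * k) (Num.bound (M ^+ e / c)).
apply: (limn_einf_ge _ _ _ N) => n; rewrite geq_max => /andP[kn Mn].
have k_n : (k <= n)%N by rewrite (leq_trans _ kn)// leq_pmull.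
have n0 : (0 < n)%N by rewrite (leq_ltn_trans _ (leq_trans j0k k_n)).
have Pp := eigenpolyP _ _ _ _ hT hj0 htwo n (ltnW (leq_trans j0k k_n)).
move: (eigenpoly k Q n) Pp => p Pp.
have [] := @max_root_modulusP R p; first by case: Pp => _ ->.
set r := max_root_modulus p => _ pr.
have {}bound : c * n%:R ^+ s <= (Num.max (2 * r) M) ^+ e.
  have rho0 : 0 <= Num.max (2 * r) M by rewrite le_max (ltW M_gt0) orbT.
  rewrite -lecR rmorphM/= !rmorphXn/= rmorph_nat.
  have := bound n p r%:C (Num.max (2 * r) M)%:C kn Pp.
  have -> : 2 * r%:C = (2 * r)%:C by rewrite rmorphM/= rmorph_nat.
  rewrite ger0_norm ?lecR// !le_max !lexx orbT; apply=> //.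
  by move=> w /pr; rewrite -lecR.
(* If the maximum were [M], the estimate would contradict the choice of [N]; this also makes [r]
   positive. *)
have {}bound : c * n%:R ^+ s <= (2 * r) ^+ e /\ 0 < 2 * r.
  have : M ^+ e < c * n%:R ^+ s.
    rewrite -ltr_pdivrMl// mulrC.
    have M0 : 0 <= M ^+ e / c by rewrite divr_ge0// ?exprn_ge0// ltW.
    apply: lt_le_trans (archi_boundP M0) _.
    by rewrite -natrX ler_nat (leq_trans Mn)// -{1}(expn1 n) leq_pexp2l.
  move: bound; have [rM|Mr] := leP (2 * r) M.
    by move=> /le_lt_trans/[apply]; rewrite ltxx.
  by split=> //; exact: lt_trans Mr.
case: bound => bound r0.
have nd0 : 0 < n%:R `^ d by apply: powR_gt0; rewrite ltr0n.
rewrite lee_fin ler_pdivlMr// mulrAC ler_pdivrMr// [leRHS]mulrC.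
rewrite dE powRrM -powRM ?powR_ge0 ?(ltW c_gt0)// powR_mulrn//.
have -> : 2 * r = ((2 * r) ^+ e) `^ e%:R^-1.
  by rewrite -powR_mulrn ?(ltW r0)// -powRrM mulfV// powRr1// ltW.
apply: ge0_ler_powR; rewrite ?invr_ge0// nnegrE.
  by rewrite mulr_ge0 ?exprn_ge0// ltW.
by rewrite exprn_ge0// ltW.
Qed.
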